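(* Run the algorithm ILOVETOCONBANDITS (defined in the context) with the epoch schedule $\tau_m:=2^{m-1}$ for $m\ge1$, $\tau_0=0$, solving (OP) at the end of each epoch by the Coordinate Descent Algorithm with $Q_{\mathrm{init}}=\mathbf 0$, implemented with one call to the oracle $\mathsf{AMO}$ before its loop and one call for each iteration of its loop. Then the total number of calls to $\mathsf{AMO}$ over $T$ rounds is $$\tilde O\left(\sqrt{KT/\ln(|\Pi|/\delta)}\right).$$
   Context: Setting. $A$ is a finite set of $K$ actions, $X$ a space of contexts, $\Pi\subseteq A^X$ a finite nonempty set of policies, $\mathcal D$ a distribution over $X\times[0,1]^A$, $\delta\in(0,1)$. Pairs $(x_t,r_t)$ are i.i.d. from $\mathcal D$; in round $t$ the agent observes $x_t$, randomly chooses $a_t$ (with probability $p_t(a_t)$), and receives $r_t(a_t)$. $H_t$ is the history of records $(x_i,a_i,r_i(a_i),p_i(a_i))$, $i\le t$; $\widehat{\mathbb E}_{x\sim H_t}$ is expectation over $x$ uniform among the $t$ contexts of $H_t$. $\widehat{\mathcal R}_t(\pi)=\frac1t\sum_{i=1}^t\frac{r_i(a_i)\mathbf 1\{\pi(x_i)=a_i\}}{p_i(a_i)}$; $\pi_t\in\arg\max_{\pi\in\Pi}\widehat{\mathcal R}_t(\pi)$ ($\pi_0$ arbitrary); $\widehat{\mathrm{Reg}}_t(\pi)=\widehat{\mathcal R}_t(\pi_t)-\widehat{\mathcal R}_t(\pi)$. Oracle. $\mathsf{AMO}$ takes a finite sequence of pairs of contexts and non-negative reward vectors $(x_i,r_i)$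 and returns an element of $\arg\max_{\pi\in\Pi}\sum_ir_i(\pi(x_i))$. Weights. $\Delta^\Pi=\{Q\in\mathbb R^\Pi: Q(\pi)\ge 0\ \forall\pi,\ \sum_\pi Q(\pi)\le 1\}$. For non-negative $Q$: $Q(a|x)=\sum_{\pi:\pi(x)=a}Q(\pi)$, $Q^\mu(a|x)=(1-K\mu)Q(a|x)+\mu$. (OP). Given $H_t$ and $\mu$, let $b_\pi=\widehat{\mathrm{Reg}}_t(\pi)/(\psi\mu)$ with $\psi=100$. Find $Q\in\Delta^\Pi$ with $\sum_\pi Q(\pi)b_\pi\le 2K$ and, for all $\pi\in\Pi$, $\widehat{\mathbb E}_{x\sim H_t}[1/Q^{\mu}(\pi(x)|x)]\le 2K+b_\pi$. Algorithm ILOVETOCONBANDITS. Set $\mu_0=1/(2K)$ and $\mu_m=\min\{\frac1{2K},\sqrt{\ln(16\tau_m^2|\Pi|/\delta)/(K\tau_m)}\}$ for $m\ge 1$; $Q_0=\mathbf 0$, $m=1$. In each round $t=1,2,\dots$: observe $x_t$; let $\tilde Q_{m-1}=Q_{m-1}+(1-\sum_\pi Q_{m-1}(\pi))\mathbf 1_{\pi_{\tau_{m-1}}}$; draw $a_t$ from $\tilde Q_{m-1}^{\mu_{m-1}}(\cdot|x_t)$ and set $p_t(a_t)=\tilde Q_{m-1}^{\mu_{m-1}}(a_t|x_t)$; observe $r_t(a_t)$; if $t=\tau_m$, let $Q_m$ be a solution of (OP) with history $H_t$ and minimum probability $\mu_m$, and set $m:=m+1$. Coordinate Descent Algorithm.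 Input $H_t$, $\mu$, $Q_{\mathrm{init}}\in\Delta^\Pi$. For each $\pi,Q$ define $V_\pi(Q)=\widehat{\mathbb E}_{x\sim H_t}[1/Q^\mu(\pi(x)|x)]$, $S_\pi(Q)=\widehat{\mathbb E}_{x\sim H_t}[1/(Q^\mu(\pi(x)|x))^2]$, $D_\pi(Q)=V_\pi(Q)-(2K+b_\pi)$. Set $Q:=Q_{\mathrm{init}}$. Loop (each pass is one iteration): (i) if $\sum_\pi Q(\pi)(2K+b_\pi)>2K$, replace $Q$ by $cQ$ with $c=2K/\sum_\pi Q(\pi)(2K+b_\pi)$; (ii) if there is a policy $\pi$ with $D_\pi(Q)>0$, pick such a $\pi$ and add $\alpha_\pi(Q)=\frac{V_\pi(Q)+D_\pi(Q)}{2(1-K\mu)S_\pi(Q)}$ to $Q(\pi)$; otherwise halt and output $Q$. Notation. $\tilde O$ suppresses factors logarithmic in $T$, $K$ and $\ln(|\Pi|/\delta)$: a count is $\tilde O(g)$ if it is at most $C\max\{1,g\}\bigl(\ln(e+T+K+\ln(|\Pi|/\delta))\bigr)^p$ for universal constants $C,p$. *)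

(* Defs.v *)
From HB Require Import structures.
From mathcomp Require Import all_boot all_order all_algebra finmap.
From mathcomp Require Import all_classical all_reals all_analysis.

Set Implicit Arguments.
Unset Strict Implicit.
Unset Printing Implicit Defensive.
Import Order.TTheory GRing.Theory Num.Theory.

Local Open Scope classical_set_scope.
Local Open Scope ring_scope.

(* The actions are 'I_K.  A policy class Pi : {fset (X -> 'I_K)} is used as the
   finite type of its members: pi : Pi is a policy, val pi : X -> 'I_K is the
   underlying function, and weight vectors are functions Pi -> R. *)

Section Policies.
Context {R : realType} {K : nat} {d : measure_display} {X : measurableType d}.
Context (Pi : {fset (X -> 'I_K)}).

Record observation := Observation
  { obs_ctx : X; obs_act : 'I_K; obs_rew : R; obs_prob : R }.

Definition history := seq observation.

Definition empE (h : history) (f : X -> R) : R :=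
  (size h)%:R^-1 * \sum_(o <- h) f (obs_ctx o).

Definition ips_reward (h : history) (pi : Pi) : R :=
  (size h)%:R^-1 *
  \sum_(o <- h) obs_rew o * (val pi (obs_ctx o) == obs_act o)%:R / obs_prob o.

Definition is_leader (h : history) (lead : Pi) : Prop :=
  forall pi, ips_reward h pi <= ips_reward h lead.

Definition regret (h : history) (lead pi : Pi) : R :=
  ips_reward h lead - ips_reward h pi.

Definition cond (Q : Pi -> R) (a : 'I_K) (x : X) : R :=
  \sum_(pi : Pi | val pi x == a) Q pi.

Definition smooth (mu : R) (Q : Pi -> R) (a : 'I_K) (x : X) : R :=
  (1 - K%:R * mu) * cond Q a x + mu.

Definition complete (Q : Pi -> R) (lead : Pi) (pi : Pi) : R :=
  Q pi + (1 - \sum_(pi' : Pi) Q pi') * (pi == lead)%:R.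

Definition psi : R := 100.

Section CoordinateDescent.
(* lead is the maximiser of ips_reward h with respect to which regrets, and
   hence the coefficients bpi, are taken. *)
Variables (h : history) (mu : R) (lead : Pi).

Definition bpi (pi : Pi) : R := regret h lead pi / (psi * mu).

Definition Vpi (Q : Pi -> R) (pi : Pi) : R :=
  empE h (fun x => (smooth mu Q (val pi x) x)^-1).

Definition Spi (Q : Pi -> R) (pi : Pi) : R :=
  empE h (fun x => (smooth mu Q (val pi x) x ^+ 2)^-1).

Definition Dpi (Q : Pi -> R) (pi : Pi) : R :=
  Vpi Q pi - (2 * K%:R + bpi pi).

Definition alpha (Q : Pi -> R) (pi : Pi) : R :=
  (Vpi Q pi + Dpi Q pi) / (2 * (1 - K%:R * mu) * Spi Q pi).

Definition rescale (Q : Pi -> R) : Pi -> R :=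
  let s := \sum_(pi : Pi) Q pi * (2 * K%:R + bpi pi) in
  if 2 * K%:R < s then fun pi => 2 * K%:R / s * Q pi else Q.

Definition violated (Q : Pi -> R) : bool := [exists pi : Pi, 0 < Dpi Q pi].

(* The passes through the loop are numbered 1, 2, ... and pick j is the policy
   chosen in pass j.  cd_state j is the value of Q after j passes; it is
   continued past a halting pass so as to be total. *)
Variables (Qinit : Pi -> R) (pick : nat -> Pi).

Fixpoint cd_state (j : nat) : Pi -> R :=
  if j is i.+1 then
    let Q := rescale (cd_state i) in
    if violated Q then
      fun pi => Q pi + alpha Q (pick j) * (pi == pick j)%:R
    else Q
  else Qinit.

Definition valid_picks : Prop :=
  forall i, let Q := rescale (cd_state i) in
  violated Q -> 0 < Dpi Q (pick i.+1).

(* Pass n is the one that halts: the loop has exactly n iterations, counting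
   the halting one, and outputs cd_state n. *)
Definition cd_halts (n : nat) : Prop :=
  [/\ (0 < n)%N,
      ~~ violated (rescale (cd_state n.-1)) &
      forall i, (i < n.-1)%N -> violated (rescale (cd_state i))].

End CoordinateDescent.

Definition query := seq (X * K.-tuple R).

Definition nonneg_query (s : query) : Prop :=
  forall z, z \in s -> forall a, 0 <= tnth z.2 a.

Definition is_AMO (AMO : query -> Pi) : Prop :=
  forall s, nonneg_query s -> forall pi : Pi,
  \sum_(z <- s) tnth z.2 (val pi z.1) <=
  \sum_(z <- s) tnth z.2 (val (AMO s) z.1).

End Policies.

Arguments observation R K {d} X : rename.
Arguments history R K {d} X : rename.
Arguments query R K {d} X : rename.

(* Epoch m ends with round tau m. *)
Definition tau (m : nat) : nat := if m is m'.+1 then (2 ^ m')%N else 0%N.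

(* The epoch m with tau (m - 1) < t <= tau m, for t >= 1. *)
Definition epoch (t : nat) : nat :=
  find (fun m => (t <= tau m)%N) (iota 0 t.+1).

(* N is the number of policies. *)
Definition mu_sched {R : realType} (K N : nat) (delta : R) (m : nat) : R :=
  if m is 0%N then (2 * K%:R)^-1
  else Num.min (2 * K%:R)^-1
         (Num.sqrt (ln (16 * (tau m)%:R ^+ 2 * N%:R / delta)
                    / (K%:R * (tau m)%:R))).

Section Algorithm.
Context {R : realType} {K : nat} {d d' : measure_display}.
Context {X : measurableType d} {Omega : measurableType d'}.
Context (Pi : {fset (X -> 'I_K)}).

(* Rounds and epochs are numbered from 1 (the values of ex_pair and ex_act at 0
   are unused).  ex_leader m is the empirical leader after tau m rounds and
   ex_weight m is Q_m.  ex_query w m 0 is the argument of the oracle call made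
   before the loop of the coordinate descent of epoch m, and ex_query w m j
   that of the call made in its j-th pass. *)
Record execution := Execution
  { ex_pair : nat -> Omega -> X * K.-tuple R;
    ex_act : nat -> Omega -> 'I_K;
    ex_leader : nat -> Omega -> Pi;
    ex_weight : nat -> Omega -> Pi -> R;
    ex_query : Omega -> nat -> nat -> query R K X }.

Variables (delta : R) (e : execution).

Definition mu (m : nat) : R := mu_sched K #|` Pi | delta m.

Definition ctx (t : nat) (w : Omega) : X := (ex_pair e t w).1.

Definition rew (t : nat) (w : Omega) (a : 'I_K) : R := tnth (ex_pair e t w).2 a.

Definition draw_prob (t : nat) (w : Omega) (a : 'I_K) : R :=
  let m := (epoch t).-1 in
  smooth (mu m) (complete (ex_weight e m w) (ex_leader e m w)) a (ctx t w).

Definition obs (w : Omega) (t : nat) : observation R K X :=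
  let a := ex_act e t w in
  Observation (ctx t w) a (rew t w a) (draw_prob t w a).

Definition hist (t : nat) (w : Omega) : history R K X :=
  [seq obs w i | i <- iota 1 t].

(* F t is the information available after round t, and G t the information
   just before the draw of the action of round t, including the context and
   the whole reward vector of round t.  The pair of round t + 1 has law D and
   is independent of F t (so that the pairs are i.i.d.), and the conditional
   law of the action of round t given G t is draw_prob t. *)
Record interaction (D : probability (X * K.-tuple R)%type R)
    (P : probability Omega R) (F G : nat -> set (set Omega)) : Prop := {
  int_F_sigma : forall t, sigma_algebra setT (F t);
  int_G_sigma : forall t, sigma_algebra setT (G t.+1);
  int_F_measurable : forall t, F t `<=` measurable;
  int_FG : forall t, F t `<=` G t.+1;
  int_GF : forall t, G t.+1 `<=` F t.+1;
  int_rew : forall t w a, 0 <= rew t.+1 w a <= 1;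
  int_pair_adapted : forall t B, measurable B -> G t.+1 (ex_pair e t.+1 @^-1` B);
  int_pair_law : forall t E B, F t E -> measurable B ->
    P (E `&` ex_pair e t.+1 @^-1` B) = (P E * D B)%E;
  int_prob_adapted : forall t a (B : set R), measurable B ->
    G t.+1 ((fun w => draw_prob t.+1 w a) @^-1` B);
  int_act_adapted : forall t a, F t.+1 (ex_act e t.+1 @^-1` [set a]);
  int_act_law : forall t a E, G t.+1 E ->
    P (E `&` ex_act e t.+1 @^-1` [set a])
      = (\int[P]_(w in E) (draw_prob t.+1 w a)%:E)%E }.

Definition zero_weights : Pi -> R := fun=> 0.

Variable AMO : query R K X -> Pi.

Definition epoch_pick (w : Omega) (m j : nat) : Pi := AMO (ex_query e w m j).

Definition epoch_state (w : Omega) (m n : nat) : Pi -> R :=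
  cd_state (hist (tau m) w) (mu m) (ex_leader e m w)
    zero_weights (epoch_pick w m) n.

Definition epoch_halts (w : Omega) (m n : nat) : Prop :=
  cd_halts (hist (tau m) w) (mu m) (ex_leader e m w)
    zero_weights (epoch_pick w m) n.

(* The queries are left unspecified, so their answers are constrained only by
   alg_leader and alg_picks.  Termination of the loop is not assumed: were the
   loop of epoch m not to halt, ex_weight m would be unconstrained. *)
Record runs_algorithm : Prop := {
  alg_weight0 : forall w, ex_weight e 0 w = zero_weights;
  alg_query : forall w m j, nonneg_query (ex_query e w m j);
  alg_call : forall w m, ex_leader e m.+1 w = AMO (ex_query e w m.+1 0);
  alg_leader : forall w m,
    is_leader (hist (tau m.+1) w) (ex_leader e m.+1 w);
  alg_picks : forall w m,
    valid_picks (hist (tau m.+1) w) (mu m.+1) (ex_leader e m.+1 w)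
      zero_weights (epoch_pick w m.+1);
  alg_weight : forall w m n, epoch_halts w m.+1 n ->
    ex_weight e m.+1 w = epoch_state w m.+1 n }.

(* Total number of oracle calls made at the ends of the epochs completed within
   T rounds, when the loop of epoch m has n m iterations.  The bound m <= T in
   the range loses nothing, as m <= tau m. *)
Definition AMO_calls (n : nat -> nat) (T : nat) : nat :=
  (\sum_(1 <= m < T.+1 | tau m <= T) (1 + n m))%N.

End Algorithm.

Arguments execution R {K d d' X} Omega Pi.

(* Main.v *)
Require Import Defs.
From HB Require Import structures.
From mathcomp Require Import all_boot all_order all_algebra finmap.
From mathcomp Require Import all_classical all_reals all_analysis.
From mathcomp Require Import ring lra.

Set Implicit Arguments.
Unset Strict Implicit.
Unset Printing Implicit Defensive.
Import Order.TTheory GRing.Theory Num.Theory.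

Local Open Scope classical_set_scope.
Local Open Scope ring_scope.

(* The loop is analysed with the potential
     g(Q) = sum_pi Q(pi) (2K + b_pi) - 2 / (1 - K mu) E_x sum_a ln Q^mu(a|x).
   Rescaling does not increase g: by ln y <= y - 1 this reduces to
   sum_a Q(a|x) / Q^mu(a|x) <= K for sum_pi Q(pi) <= 1, a tangent-line bound.
   A step alpha along a violated policy minimises the quadratic upper bound on g
   given by ln (1 + y) >= y - y^2 / 2, and lowers g by at least
   K mu / (2 (1 - K mu)).  Since ln (K y) <= K y - 1 bounds g from below, a loop
   started at 0 makes at most 4 ln (1 / (K mu)) / mu steps.
   When mu = 1 / (2K) no policy is ever violated, because V_pi <= 1 / mu = 2K;
   this removes the 2K that 1 / mu would otherwise contribute.  In every other
   epoch 1 / mu_m <= sqrt (K tau_m / L), and there are O(log T) epochs.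
   The argument is deterministic: it holds for every outcome w. *)

(** * Tangent and quadratic bounds for the logarithm *)

Section Logarithm.
Context {R : realType}.
Implicit Types x y : R.

Lemma ln_le_sub1 x : 0 < x -> ln x <= x - 1.
Proof.
by move=> x0; have := @le_ln1Dx R (x - 1); rewrite subrKC; apply; lra.
Qed.

Lemma ln2_ge : 2^-1 <= ln (2 : R).
Proof.
have := @ln_le_sub1 2^-1; rewrite lnV ?posrE// invr_gt0 => /(_ (ltr0Sn R 1)).
lra.
Qed.

(** The difference of the two sides vanishes at 1 and has derivative (u - 1)^2 / u >= 0. *)
Lemma ln_ge_quad x : 1 <= x -> (x - 1) - (x - 1) ^+ 2 / 2 <= ln x.
Proof.
move=> x1; pose f (u : R) : R := ln u - (u - 1) + (u - 1) ^+ 2 / 2.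
have df (u : R) : 0 < u -> is_derive u 1 f (u^-1 - 1 + (u - 1)).
  move=> u0; rewrite /f.
  have lnu := is_derive1_ln u0.
  by apply: is_derive_eq; rewrite /GRing.scale/=; lra.
suff : f 1 <= f x by rewrite /f ln1 => ?; lra.
apply: (@ger0_derive1_ndecr _ f 1 x) => //.
- move=> u /[!in_itv]/= /andP[u1 _]; have u0 : 0 < u by lra.
  by have [] := df _ u0.
- move=> u /[!in_itv]/= /andP[u1 _]; have u0 : 0 < u by lra.
  rewrite derive1E (@derive_val _ _ _ _ _ _ _ (df _ u0)).
  have -> : u^-1 - 1 + (u - 1) = (u - 1) ^+ 2 / u by field; lra.
  by rewrite divr_ge0 ?sqr_ge0// ltW.
- apply: derivable_within_continuous => u /[!in_itv]/= /andP[u1 _].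
  have u0 : 0 < u by lra.
  by have [] := df _ u0.
Qed.

End Logarithm.

(** * Empirical averages, smoothed probabilities and the potential *)

Section CoordinateDescent.
Context {R : realType} {K : nat} {d : measure_display} {X : measurableType d}.
Context (Pi : {fset (X -> 'I_K)}) (h : history R K X) (mu : R) (lead : Pi).
Implicit Types (Q : Pi -> R) (f g : X -> R) (x : X) (pi : Pi).

Lemma empE_le f g : (forall x, f x <= g x) -> empE h f <= empE h g.
Proof.
move=> fg; rewrite ler_wpM2l ?invr_ge0 ?ler0n//.
by apply: ler_sum.
Qed.

Lemma empE_lin a b f g :
  empE h (fun x => a * f x + b * g x) = a * empE h f + b * empE h g.
Proof. by rewrite /empE big_split/= -!mulr_sumr; ring. Qed.

Lemma empE_cst c : (0 < size h)%N -> empE h (fun=> c) = c.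
Proof.
move=> h0; rewrite /empE big_const_seq count_predT iter_addr_0.
by rewrite -(mulr_natl c) mulrA mulVf ?mul1r// pnatr_eq0 -lt0n.
Qed.

Lemma empE_gt0 f : (0 < size h)%N -> (forall x, 0 < f x) -> 0 < empE h f.
Proof.
move=> h0 f0; rewrite /empE mulr_gt0 ?invr_gt0 ?ltr0n//.
case: h h0 => // o s _; rewrite big_cons ltr_pwDl//.
by apply: sumr_ge0 => i _; exact: ltW.
Qed.

Lemma sum_cond Q x : \sum_a cond Q a x = \sum_pi Q pi.
Proof. by rewrite (partition_big (fun pi : Pi => val pi x) predT)//=. Qed.

Lemma sum_smooth Q x :
  \sum_a smooth mu Q a x = (1 - K%:R * mu) * (\sum_pi Q pi) + K%:R * mu.
Proof.
rewrite /smooth big_split/= -mulr_sumr sum_cond sumr_const card_ord.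
by rewrite -[mu *+ K]mulr_natl.
Qed.

Lemma cond_scale c Q a x : cond (fun pi => c * Q pi) a x = c * cond Q a x.
Proof. by rewrite /cond mulr_sumr. Qed.

Lemma cond_ge0 Q a x : (forall pi, 0 <= Q pi) -> 0 <= cond Q a x.
Proof. by move=> Q0; apply: sumr_ge0. Qed.

Lemma cond_add Q c pi a x :
  cond (fun pi' => Q pi' + c * (pi' == pi)%:R) a x =
  cond Q a x + c * (a == val pi x)%:R.
Proof.
rewrite /cond big_split/=; congr (_ + _).
rewrite -mulr_sumr; congr (_ * _).
case: (eqVneq a (val pi x)) => [->|ne].
  rewrite (bigD1 pi)//= eqxx big1 ?addr0// => i /andP[_ /negPf ->]//.
rewrite big1 // => i /eqP ix; case: (eqVneq i pi) => // ipi.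
by move: ne; rewrite -ix ipi eqxx.
Qed.

Hypotheses (K0 : (0 < K)%N) (h0 : (0 < size h)%N) (mu0 : 0 < mu).
Hypothesis Kmu : K%:R * mu <= 2^-1.
Hypothesis leadP : is_leader h lead.

Local Notation b := (bpi h mu lead).
Local Notation nu := (1 - K%:R * mu).

Let nu0 : 0 < nu.
Proof. by rewrite subr_gt0 (le_lt_trans Kmu)// invf_lt1 ?ltr1n ?ltr0n. Qed.

Let KR : 0 < K%:R :> R.
Proof. by rewrite ltr0n. Qed.

Lemma bpi_ge0 pi : 0 <= b pi.
Proof.
rewrite /bpi divr_ge0//; first by rewrite /regret subr_ge0.
by rewrite mulr_ge0 ?ltW// /psi ler0n.
Qed.

Lemma smooth_ge Q a x : (forall pi, 0 <= Q pi) -> mu <= smooth mu Q a x.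
Proof. by move=> Q0; rewrite /smooth lerDr mulr_ge0 ?cond_ge0// ltW. Qed.

Lemma smooth_gt0 Q a x : (forall pi, 0 <= Q pi) -> 0 < smooth mu Q a x.
Proof. by move=> Q0; exact: (lt_le_trans mu0 (smooth_ge a x Q0)). Qed.

(** With nu = 1 - K mu, the first and second partial derivatives in Q(pi) are -(V_pi + D_pi) and 2
    nu S_pi, so that [alpha] is the Newton step along coordinate pi. *)
Definition potential Q : R :=
  \sum_pi Q pi * (2 * K%:R + b pi) -
  2 / nu * empE h (fun x => \sum_a ln (smooth mu Q a x)).

Lemma potential0 :
  potential (zero_weights (Pi := Pi)) = - (2 * K%:R / nu * ln mu).
Proof.
rewrite /potential big1 ?sub0r => [|pi _]; last by rewrite mul0r.
have -> : (fun x => \sum_(a < K) ln (smooth mu (zero_weights (Pi := Pi)) a x))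
   = fun=> K%:R * ln mu.
  apply/funext => x; rewrite -[K in RHS]card_ord mulr_natl -sumr_const.
  by apply: eq_bigr => a _; rewrite /smooth /cond big1// mulr0 add0r.
by rewrite empE_cst//; congr -%R; ring.
Qed.

(** Summing ln (K q) <= K q - 1 over the actions bounds the logarithms through the total mass of Q.
    Since b_pi >= 0, the linear part is at least 2K times that mass, so the mass cancels and the
    bound is free of Q. *)
Lemma potential_ge Q : (forall pi, 0 <= Q pi) ->
  2 * K%:R / nu * ln K%:R + 2 * K%:R <= potential Q.
Proof.
move=> Q0; rewrite /potential.
have H x : \sum_a ln (smooth mu Q a x) <=
    K%:R * (nu * (\sum_pi Q pi) + K%:R * mu - 1 - ln K%:R).
  apply: (@le_trans _ _ (\sum_(a < K) (K%:R * smooth mu Q a x - 1 - ln K%:R))).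
    apply: ler_sum => a _; have q0 := smooth_gt0 a x Q0.
    rewrite lerBrDr addrC -lnM ?posrE//; apply: ln_le_sub1.
    by rewrite mulr_gt0.
  rewrite !sumrB !sumr_const card_ord -mulr_sumr sum_smooth.
  by rewrite -[ln _ *+ K]mulr_natr le_eqVlt; apply/orP; left; apply/eqP; ring.
have := empE_le H; rewrite empE_cst// => {}H.
have S2 : 2 * K%:R * (\sum_pi Q pi) <= \sum_pi Q pi * (2 * K%:R + b pi).
  rewrite mulr_sumr; apply: ler_sum => pi _.
  by rewrite mulrC ler_wpM2l// lerDl bpi_ge0.
have n2 : 0 <= 2 / nu by rewrite divr_ge0 ?ltW.
have := ler_wpM2l n2 H.
suff -> : 2 / nu * (K%:R * (nu * (\sum_pi Q pi) + K%:R * mu - 1 - ln K%:R)) =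
  2 * K%:R * (\sum_pi Q pi) - 2 * K%:R - 2 * K%:R / nu * ln K%:R by lra.
by field; rewrite gt_eqF.
Qed.

(** * The rescaling step *)

Lemma sum_cond_div_smooth_le Q x :
  (forall pi, 0 <= Q pi) -> \sum_pi Q pi <= 1 ->
  \sum_a cond Q a x / smooth mu Q a x <= K%:R.
Proof.
move=> Q0 Q1.
(* The tangent at 1 / K of the concave function q / (nu q + mu). *)
apply: (@le_trans _ _
    (\sum_(a < K) (1 + mu * K%:R ^+ 2 * (cond Q a x - K%:R^-1)))).
  apply: ler_sum => a _; have s0 := smooth_gt0 a x Q0.
  rewrite ler_pdivrMr// /smooth -subr_ge0.
  (* Once the denominator is cleared, the gap to the tangent is a nonnegative multiple of a
     square. *)
  rewrite [leRHS](_ : _ =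
      K%:R * mu * nu * K%:R * (cond Q a x - K%:R^-1) ^+ 2); last first.
    by field; rewrite gt_eqF.
  by rewrite mulr_ge0 ?sqr_ge0// !mulr_ge0// ltW.
rewrite big_split/= -mulr_sumr sumrB sum_cond.
rewrite !sumr_const card_ord -[K%:R^-1 *+ K]mulr_natl mulfV ?gt_eqF//.
by rewrite gerDl; apply: mulr_ge0_le0; [rewrite mulr_ge0 ?sqr_ge0// ltW|lra].
Qed.

Lemma rescale_ge0 Q : (forall pi, 0 <= Q pi) ->
  forall pi, 0 <= rescale h mu lead Q pi.
Proof.
move=> Q0 pi; rewrite /rescale; case: ifP => // lts.
rewrite mulr_ge0// divr_ge0 ?mulr_ge0 ?ler0n//.
by apply/ltW/(le_lt_trans _ lts); rewrite mulr_ge0.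
Qed.

(** Scaling by c = 2K / s lowers the linear part from 2K / c to 2K, and the logarithmic part costs
    at most that same difference. *)
Lemma potential_rescale Q : (forall pi, 0 <= Q pi) ->
  potential (rescale h mu lead Q) <= potential Q.
Proof.
move=> Q0; have rQ0 := rescale_ge0 Q0; move: rQ0.
rewrite /rescale; case: ifP => // lts.
set s := \sum_pi _ in lts *.
have s0 : 0 < s by apply: le_lt_trans lts; rewrite mulr_ge0.
set c := 2 * K%:R / s; set cQ := fun pi => c * Q pi => cQ0.
have c0 : 0 < c by rewrite divr_gt0// mulr_gt0.
have c1 : c < 1 by rewrite ltr_pdivrMr// mul1r.
have cs : c * s = 2 * K%:R by rewrite divfK// gt_eqF.
have scQ : \sum_pi cQ pi * (2 * K%:R + b pi) = 2 * K%:R.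
  by rewrite -[RHS]cs mulr_sumr; apply: eq_bigr => pi _; rewrite mulrA.
(* The scaled weights cost 2K in total and each unit of weight costs at least 2K, hence the mass is
   at most 1, as the tangent bound requires. *)
have cQ1 : \sum_pi cQ pi <= 1.
  rewrite -(ler_pM2r (x := 2 * K%:R)) ?mulr_gt0// mul1r -[leRHS]scQ mulr_suml.
  apply: ler_sum => pi _; apply: (ler_wpM2l (cQ0 pi)).
  by rewrite lerDl bpi_ge0.
have H x : \sum_a ln (smooth mu Q a x) <=
    1 * \sum_a ln (smooth mu cQ a x) + (nu * (1 - c) * (K%:R / c)) * 1.
  rewrite mul1r mulr1 -lerBlDl -sumrB.
  (* For q and q' the smoothed probabilities under Q and [cQ], ln (q / q') <= q / q' - 1, which
     equals nu (1 - c) / c times [cond cQ a x] / q'. *)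
  apply: (@le_trans _ _
      (nu * (1 - c) * (\sum_a cond cQ a x / smooth mu cQ a x / c))).
    rewrite mulr_sumr; apply: ler_sum => a _.
    have q0 := smooth_gt0 a x Q0; have cq0 := smooth_gt0 a x cQ0.
    rewrite -ln_div ?posrE//.
    apply: (le_trans (ln_le_sub1 _)); first by rewrite divr_gt0.
    rewrite le_eqVlt; apply/orP; left; apply/eqP.
    move: cq0; rewrite /smooth /cQ cond_scale => cq0.
    by field; rewrite !gt_eqF.
  apply: ler_wpM2l; first by rewrite mulr_ge0 ?ltW// subr_gt0.
  by rewrite -mulr_suml ler_pM2r ?invr_gt0// sum_cond_div_smooth_le.
have := empE_le H; rewrite empE_lin empE_cst// => {}H.
rewrite /potential -/s scQ.
have n2 : 0 <= 2 / nu by rewrite divr_ge0 ?ltW.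
have := ler_wpM2l n2 H.
rewrite mul1r mulr1.
have sE : s = 2 * K%:R / c by rewrite -cs mulrC mulKf// gt_eqF.
rewrite sE mulrDr.
have -> : 2 / nu * (nu * (1 - c) * (K%:R / c)) = 2 * K%:R / c - 2 * K%:R.
  by field; rewrite !gt_eqF.
lra.
Qed.

(** * The coordinate step *)

Lemma Spi_gt0 Q pi : (forall pi, 0 <= Q pi) -> 0 < Spi h mu Q pi.
Proof.
by move=> Q0; apply: empE_gt0 => // x; rewrite invr_gt0 exprn_gt0// smooth_gt0.
Qed.

Lemma Spi_le_Vpi Q pi : (forall pi, 0 <= Q pi) ->
  mu * Spi h mu Q pi <= Vpi h mu Q pi.
Proof.
move=> Q0.
(* The zero summand only gives the left side the shape of [empE_lin]. *)
have H x : mu * (smooth mu Q (val pi x) x ^+ 2)^-1 + 0 * 0 <=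
    (smooth mu Q (val pi x) x)^-1.
  have q0 := smooth_gt0 (val pi x) x Q0.
  rewrite mulr0 addr0 -exprVn expr2 mulrA.
  apply: ler_piMl; first by rewrite invr_ge0 ltW.
  by rewrite ler_pdivrMr// mul1r smooth_ge.
by have := empE_le H; rewrite empE_lin mul0r addr0.
Qed.

Lemma alpha_ge0 Q pi : (forall pi, 0 <= Q pi) -> 0 < Dpi h mu lead Q pi ->
  0 <= alpha h mu lead Q pi.
Proof.
move=> Q0 D0; have S0 := Spi_gt0 pi Q0; apply: divr_ge0.
  apply/ltW/addr_gt0 => //; apply: lt_le_trans (Spi_le_Vpi _ Q0).
  exact: mulr_gt0.
by apply: mulr_ge0; [apply: mulr_ge0 => //|]; exact: ltW.
Qed.

(** A step y changes the potential by at most -(y (V + D) - nu y^2 S). At y = [alpha] the decrease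
    is (V + D)^2 / (4 nu S), which is then bounded below independently of Q. *)
Lemma potential_step Q pi : (forall pi, 0 <= Q pi) -> 0 < Dpi h mu lead Q pi ->
  potential (fun pi' => Q pi' + alpha h mu lead Q pi * (pi' == pi)%:R)
    + K%:R * mu / (2 * nu) <= potential Q.
Proof.
move=> Q0 D0; have S0 := Spi_gt0 pi Q0; have SV := Spi_le_Vpi pi Q0.
have b0 := bpi_ge0 pi.
set y := alpha _ _ _ _ _; set V := Vpi _ _ _ _ in SV.
set S := Spi _ _ _ _ in S0 SV.
set Dp := Dpi _ _ _ _ _ in D0.
have VD : V = Dp + (2 * K%:R + b pi) by rewrite /Dp /Dpi subrK.
have V0 : 0 < V by rewrite VD addr_gt0// ltr_pwDl// mulr_gt0.
have yE : y = (V + Dp) / (2 * nu * S) by [].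
have y0 : 0 <= y by exact: alpha_ge0.
have sE : \sum_pi' (Q pi' + y * (pi' == pi)%:R) * (2 * K%:R + b pi') =
    \sum_pi' Q pi' * (2 * K%:R + b pi') + y * (2 * K%:R + b pi).
  under eq_bigr do rewrite mulrDl.
  rewrite big_split/=; congr (_ + _).
  rewrite (bigD1 pi)//= eqxx mulr1 big1 ?addr0// => i /negPf ->.
  by rewrite mulr0 mul0r.
(* Only the summand of the action pi(x) changes: its argument q is multiplied by 1 + u with u = nu y
   / q >= 0, and ln (1 + u) >= u - u^2 / 2. *)
have H x : 1 * (\sum_a ln (smooth mu Q a x)) + 1 *
    (nu * y * (smooth mu Q (val pi x) x)^-1 +
     - ((nu * y) ^+ 2 / 2) * (smooth mu Q (val pi x) x ^+ 2)^-1) <=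
    \sum_a ln (smooth mu (fun pi' => Q pi' + y * (pi' == pi)%:R) a x).
  rewrite !mul1r (bigD1 (val pi x))//= [leRHS](bigD1 (val pi x))//=.
  rewrite [X in _ <= _ + X](eq_bigr (fun a => ln (smooth mu Q a x))); last first.
    by move=> a /negPf ax; rewrite /smooth cond_add ax mulr0 addr0.
  rewrite addrAC lerD2r.
  set q := smooth mu Q (val pi x) x; have q0 : 0 < q by exact: smooth_gt0.
  have -> : smooth mu (fun pi' => Q pi' + y * (pi' == pi)%:R) (val pi x) x =
      q * (1 + nu * y / q).
    rewrite [RHS]mulrDr mulr1 [q * _]mulrC divfK ?gt_eqF// /smooth cond_add.
    by rewrite eqxx mulr1 mulrDr addrAC.
  have u0 : 0 <= nu * y / q.
    by apply: divr_ge0; [apply: mulr_ge0; [exact: ltW|]|exact: ltW].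
  rewrite lnM ?posrE//; last by rewrite ltr_pwDl.
  rewrite lerD2l; have := @ln_ge_quad _ (1 + nu * y / q).
  rewrite lerDl u0 => /(_ isT); apply: le_trans.
  rewrite le_eqVlt; apply/orP; left; apply/eqP.
  by field; rewrite gt_eqF.
have := empE_le H; rewrite !empE_lin.
rewrite -/(Vpi h mu Q pi) -/(Spi h mu Q pi) -/V -/S.
rewrite /potential sE => {}H.
have n2 : 0 <= 2 / nu by rewrite divr_ge0 ?ltW.
have := ler_wpM2l n2 H.
have E1 : y * (V + Dp) - nu * y ^+ 2 * S = (V + Dp) ^+ 2 / (4 * nu * S).
  by rewrite yE; field; rewrite !gt_eqF.
(* D > 0 and b_pi >= 0 give V >= 2K; together with V >= mu S this yields (V + D)^2 >= V^2 >= 2K mu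
   S. *)
have E2 : K%:R * mu / (2 * nu) <= (V + Dp) ^+ 2 / (4 * nu * S).
  have nu20 : 0 < 2 * nu by exact: mulr_gt0.
  have nuS0 : 0 < 4 * nu * S by apply: mulr_gt0 => //; exact: mulr_gt0.
  rewrite ler_pdivrMr// mulrAC ler_pdivlMr//.
  have VK : 2 * K%:R <= V by rewrite VD; lra.
  have KS : 2 * K%:R * (mu * S) <= V * V.
    by apply: ler_pM => //; apply: mulr_ge0 => //; exact: ltW.
  have VV : V * V <= (V + Dp) ^+ 2.
    by rewrite expr2; apply: ler_pM; rewrite ?lerDl; exact: ltW.
  rewrite [leLHS](_ : _ = 2 * K%:R * (mu * S) * (2 * nu)); last ring.
  apply: ler_wpM2r; last exact: le_trans KS VV.
  by apply: mulr_ge0 => //; exact: ltW.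
set E0 := empE _ _ in H *; set E' := empE _ _ in H *.
rewrite !mul1r => {}H.
have E3 : 2 / nu * (E0 + (nu * y * V + - ((nu * y) ^+ 2 / 2) * S)) =
   2 / nu * E0 + 2 * y * V - nu * y ^+ 2 * S.
  by field; rewrite gt_eqF.
rewrite E3 VD in H.
rewrite VD in E1 E2.
lra.
Qed.

Lemma violated_large_mu Q : (forall pi, 0 <= Q pi) -> 1 <= 2 * K%:R * mu ->
  ~~ violated h mu lead Q.
Proof.
move=> Q0 Kmu1; apply/existsPn => pi; rewrite -leNgt /Dpi subr_le0.
apply: (@le_trans _ _ (empE h (fun=> mu^-1))).
  by apply: empE_le => x; rewrite lef_pV2 ?posrE ?smooth_gt0// smooth_ge.
rewrite empE_cst// -[leLHS]mul1r ler_pdivrMr// (le_trans Kmu1)//.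
by rewrite ler_pM2r// lerDl bpi_ge0.
Qed.

(** * Termination of the loop and the number of its passes *)

Section Passes.
Variable pick : nat -> Pi.
Hypothesis picks : valid_picks h mu lead (zero_weights (Pi := Pi)) pick.

Local Notation Qn := (cd_state h mu lead (zero_weights (Pi := Pi)) pick).

Lemma cd_state_ge0 i pi : 0 <= Qn i pi.
Proof.
elim: i pi => [|i IH] pi //=.
have rQ0 := rescale_ge0 IH; case: ifP => // /picks D0.
by rewrite addr_ge0// mulr_ge0 ?ler0n// alpha_ge0.
Qed.

Lemma potential_cd_state i :
  (forall j, (j < i)%N -> violated h mu lead (rescale h mu lead (Qn j))) ->
  potential (Qn i) + i%:R * (K%:R * mu / (2 * nu)) <=
  potential (zero_weights (Pi := Pi)).
Proof.
elim: i => [_|i IH vio]; first by rewrite mul0r addr0.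
have {}IH := IH (fun j ji => vio j (ltnW ji)).
have v := vio i (ltnSn i); rewrite /= v.
have := potential_step (rescale_ge0 (cd_state_ge0 i)) (picks v).
have := potential_rescale (cd_state_ge0 i).
move: IH; set A := K%:R * mu / (2 * nu).
rewrite -[i.+1%:R]natr1 [(_ + 1) * A]mulrDl mul1r => ? ? ?; lra.
Qed.

(** The potential at 0, less i decrements, still exceeds the uniform lower bound. The spare 2K is
    dropped and the common factor K / (2 nu) cancelled. *)
Lemma violated_passes_le i :
  (forall j, (j < i)%N -> violated h mu lead (rescale h mu lead (Qn j))) ->
  i%:R * mu <= 4 * ln (K%:R * mu)^-1.
Proof.
move=> vio; have := potential_cd_state vio; have := potential_ge (cd_state_ge0 i).
rewrite potential0 lnV ?posrE ?mulr_gt0// lnM ?posrE// => H1 H2.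
have : i%:R * (K%:R * mu / (2 * nu)) + 2 * K%:R / nu * ln K%:R
    + 2 * K%:R / nu * ln mu <= 0.
  by have := KR => ?; lra.
rewrite [leLHS](_ : _ =
    K%:R / (2 * nu) * (i%:R * mu + 4 * (ln K%:R + ln mu))); last first.
  by field; rewrite gt_eqF.
by rewrite pmulr_rle0 ?divr_gt0 ?mulr_gt0//; lra.
Qed.

Lemma cd_halts_exists :
  exists2 n, cd_halts h mu lead (zero_weights (Pi := Pi)) pick n &
    n.-1%:R * mu <= 4 * ln (K%:R * mu)^-1.
Proof.
have ex : exists i, ~~ violated h mu lead (rescale h mu lead (Qn i)).
  apply: contrapT => /forallNP vio.
  pose B := 4 * ln (K%:R * mu)^-1 / mu.
  (* Were every pass violated, the bound would fail at an integer above [B]. *)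
  have := @violated_passes_le (Num.truncn B).+1
    (fun j _ => contra_notT id (vio j)).
  by rewrite -ler_pdivlMr// leNgt truncnS_gt.
case: (ex_minnP ex) => i nv minv.
have vio j : (j < i)%N -> violated h mu lead (rescale h mu lead (Qn j)).
  by move=> ji; apply: contraTT ji => /minv; rewrite -leqNgt.
(* The i violated passes are followed by the halting one, which is pass i + 1. *)
by exists i.+1; [split|exact: violated_passes_le].
Qed.

End Passes.

End CoordinateDescent.

(** * The schedule of minimum probabilities and the count of epochs *)

Section Schedule.
Context {R : realType} (K N : nat) (delta : R).
Hypotheses (K0 : (0 < K)%N) (N0 : (0 < N)%N) (delta01 : 0 < delta < 1).

Local Notation L := (ln (N%:R / delta)).
Local Notation mu m := (mu_sched K N delta m).

Let KR : 0 < K%:R :> R.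
Proof. by rewrite ltr0n. Qed.

Let Ndelta1 : 1 < N%:R / delta.
Proof.
have /andP[d0 d1] := delta01.
by rewrite ltr_pdivlMr// mul1r (lt_le_trans d1)// ler1n.
Qed.

(** L <= l lets L replace l in the bound on 1 / mu; 1 <= l gives 1 / (K mu) <= tau, which controls
    the logarithmic factor. *)
Lemma schedule_log_ge m :
  let l := ln (16 * (tau m.+1)%:R ^+ 2 * N%:R / delta) in
  1 <= l /\ L <= l.
Proof.
have tau1 : 1 <= (tau m.+1)%:R ^+ 2 :> R.
  by rewrite -natrX ler1n !expn_gt0.
move=> l; move: Ndelta1; set y := N%:R / delta => y1.
have -> : l = ln (16 * (tau m.+1)%:R ^+ 2 * y) by rewrite /l -!mulrA.
have y0 : 0 < y by rewrite (lt_trans _ y1).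
have t16 : 16 <= 16 * (tau m.+1)%:R ^+ 2 :> R by lra.
split; last first.
  rewrite ler_ln ?posrE//; last by rewrite mulr_gt0// (lt_le_trans _ t16).
  by rewrite ler_peMl ?ltW//; lra.
(* Here 16 = 2^4, and 4 ln 2 >= 2. *)
apply: (@le_trans _ _ (ln (2 ^+ 4))).
  by rewrite lnXn//; have := @ln2_ge R; lra.
rewrite ler_ln ?posrE ?exprn_gt0//; last first.
  by rewrite mulr_gt0// (lt_le_trans _ t16).
rewrite -[leLHS]mulr1; apply: ler_pM; rewrite ?exprn_ge0 ?(ltW y1)//.
by apply: le_trans t16; rewrite -natrX ler_nat.
Qed.

Lemma mu_sched_bounds m :
  0 < mu m.+1 /\ K%:R * mu m.+1 <= 2^-1.
Proof.
have [l1 _] := schedule_log_ge m; split.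
  rewrite /mu_sched lt_min invr_gt0 mulr_gt0//= sqrtr_gt0 divr_gt0//.
    exact: lt_le_trans l1.
  by rewrite mulr_gt0// ltr0n expn_gt0.
apply: (@le_trans _ _ (K%:R * (2 * K%:R)^-1)).
  by rewrite ler_pM2l// ge_min lexx.
by rewrite invfM mulrCA mulfV ?mulr1// gt_eqF.
Qed.

(** The minimum is then attained by the square root, so 1 / mu = sqrt (K tau / l). The second bound
    follows from K tau / l <= (K tau)^2. *)
Lemma mu_sched_small m : 2 * K%:R * mu m.+1 < 1 ->
  (mu m.+1)^-1 <= Num.sqrt (K%:R * (tau m.+1)%:R / L) /\
  (K%:R * mu m.+1)^-1 <= (tau m.+1)%:R.
Proof.
have [l1 lL] := schedule_log_ge m.
have tau1 : 1 <= (tau m.+1)%:R :> R by rewrite ler1n expn_gt0.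
rewrite /mu_sched; set l := ln _ in l1 lL *; set t := (tau _)%:R in tau1 *.
have l0 : 0 < l by exact: lt_le_trans l1.
have t0 : 0 < t by exact: lt_le_trans tau1.
set s := Num.sqrt _; case: (leP (2 * K%:R)^-1 s) => [_|_ _].
  by rewrite mulfV ?ltxx// mulf_neq0 ?gt_eqF.
have L0 : 0 < L by exact: ln_gt0.
have Kt0 : 0 < K%:R * t by exact: mulr_gt0.
have sE : s^-1 = Num.sqrt (K%:R * t / l).
  by rewrite /s -sqrtrV ?invf_div// ltW// divr_gt0.
have Kt1 : 1 <= K%:R * t by apply: mulr_ege1 => //; rewrite ler1n.
split.
  rewrite sE ler_sqrt; last by rewrite ltW// divr_gt0.
  by rewrite ler_pM2l// lef_pV2 ?posrE.
rewrite invfM sE -(@ler_pM2l _ K%:R)// mulVKf ?gt_eqF//.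
rewrite -[leRHS]ger0_norm ?(ltW Kt0)// -sqrtr_sqr ler_sqrt ?sqr_ge0//.
rewrite ler_pdivrMr// expr2 -mulrA ler_peMr ?(ltW Kt0)//.
exact: mulr_ege1.
Qed.

Lemma epoch_halts_exists {d : measure_display} {X : measurableType d}
    (Pi : {fset (X -> 'I_K)}) (h : history R K X) (lead : Pi)
    (pick : nat -> Pi) m :
  size h = tau m.+1 -> is_leader h lead ->
  valid_picks h (mu m.+1) lead (zero_weights (Pi := Pi)) pick ->
  exists2 n, cd_halts h (mu m.+1) lead (zero_weights (Pi := Pi)) pick n &
    n%:R <= 1 + 4 * Num.sqrt (K%:R * (tau m.+1)%:R / L) * ln (tau m.+1)%:R.
Proof.
move=> sh leadP picks; have [mu0 Kmu] := mu_sched_bounds m.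
have h0 : (0 < size h)%N by rewrite sh expn_gt0.
have tau1 : 1 <= (tau m.+1)%:R :> R by rewrite ler1n expn_gt0.
(* For large [mu] the very first pass halts; otherwise the potential bounds the n - 1 violated
   passes, and the summand 1 is the halting one. *)
have [large|small] := leP 1 (2 * K%:R * mu m.+1).
  exists 1%N; last by rewrite lerDl !mulr_ge0 ?sqrtr_ge0// ln_ge0.
  split => //; apply: violated_large_mu => // pi; exact: rescale_ge0.
have [invmu invKmu] := mu_sched_small small.
have [n halts nle] := cd_halts_exists K0 h0 mu0 Kmu leadP picks.
exists n => //; have n0 : (0 < n)%N by case: halts.
rewrite -(prednK n0) -natr1 addrC lerD2l.
apply: (@le_trans _ _ ((mu m.+1)^-1 * (4 * ln (tau m.+1)%:R))).
  rewrite -ler_pdivrMl ?invr_gt0// invrK mulrC (le_trans nle)// ler_pM2l//.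
  by rewrite ler_ln ?posrE ?invr_gt0 ?mulr_gt0// (lt_le_trans _ tau1).
by rewrite [leRHS]mulrAC [leRHS]mulrC ler_wpM2r// mulr_ge0// ln_ge0.
Qed.

(** An epoch m completed by round T has 2^(m - 1) <= T, so there are at most 1 + log_2 T of them,
    and ln 2 >= 1 / 2. *)
Lemma AMO_calls_le (n : nat -> nat) (T : nat) (B : R) : 0 <= B ->
  (forall m, (0 < m)%N -> (tau m <= T)%N -> (1 + n m)%:R <= B) ->
  (AMO_calls n T)%:R <= B * (1 + 2 * ln T%:R).
Proof.
move=> B0 nB; rewrite /AMO_calls; case: (posnP T) => [->|T0].
  by rewrite big_geq// mulr_ge0// ln0// mulr0 addr0.
(* This places the range of completed epochs inside the range of summation of [AMO_calls]. *)
have logT : (trunc_log 2 T < T)%N.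
  exact: leq_trans (ltn_expl _ (ltnSn 1)) (trunc_logP (ltnSn 1) T0).
apply: (@le_trans _ _ (\sum_(1 <= m < (trunc_log 2 T).+2) B)).
  rewrite natr_sum [leRHS](big_nat_widen _ _ T.+1)//=.
  rewrite big_nat_cond [leRHS]big_nat_cond big_mkcond [leRHS]big_mkcond.
  apply: ler_sum => -[|m] _ //=; have [mT|_] := leqP (tau m.+1) T; last first.
    by rewrite andbF; case: ifP.
  rewrite !ltnS (trunc_log_max (ltnSn 1) mT) !andbT.
  by case: ifP => // _; exact: nB.
rewrite sumr_const_nat subn1/= -(mulr_natr B); apply: ler_wpM2l => //.
rewrite -natr1 addrC lerD2l.
have logT2 : (trunc_log 2 T)%:R * ln 2 <= ln T%:R :> R.
  rewrite mulr_natl -lnXn// ler_ln ?posrE ?exprn_gt0 ?ltr0n//.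
  by rewrite -natrX ler_nat trunc_logP.
have log0 : 0 <= (trunc_log 2 T)%:R :> R by [].
have := ler_wpM2l log0 (@ln2_ge R); lra.
Qed.

End Schedule.

(** * The total number of oracle calls *)

Theorem lemma2 (R : realType) :
  exists (C : R) (p : nat),
  forall (K : nat) (d d' : measure_display)
    (X : measurableType d) (Omega : measurableType d')
    (Pi : {fset (X -> 'I_K)}) (delta : R)
    (D : probability (X * K.-tuple R)%type R) (P : probability Omega R)
    (F G : nat -> set (set Omega))
    (AMO : query R K X -> Pi) (e : execution R Omega Pi),
  Pi != fset0 ->
  0 < delta < 1 ->
  is_AMO AMO ->
  interaction delta e D P F G ->
  runs_algorithm delta e AMO ->
  forall (T : nat) (w : Omega),
  let L := ln (#|` Pi |%:R / delta) in
  exists n : nat -> nat,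
    (forall m, (0 < m)%N -> (tau m <= T)%N -> epoch_halts delta e AMO w m (n m))
    /\
    (AMO_calls n T)%:R <=
      C * Num.max 1 (Num.sqrt (K%:R * T%:R / L))
        * ln (expR 1 + T%:R + K%:R + L) ^+ p.
Proof.
(* Each epoch makes at most 2 + 4 M l <= 6 M l calls, and there are at most 1 + 2 ln T <= 3 l
   epochs, whence 18 M l^2. *)
exists 18, 2%N => K d d' X Omega Pi delta D P F G AMO e Pi0 delta01 _ _ run.
move=> T w L.
(* Some action exists, since a policy takes values in ['I_K]. *)
have K0 : (0 < K)%N.
  exact: leq_trans (ltn_ord (val (ex_leader e 0 w) (ctx e 0 w))).
have N0 : (0 < #|` Pi|)%N by rewrite cardfs_gt0.
have L0 : 0 < L.
  have /andP[d0 d1] := delta01.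
  by rewrite ln_gt0// ltr_pdivlMr// mul1r (lt_le_trans d1)// ler1n.
have ex m : exists n, (0 < m)%N -> epoch_halts delta e AMO w m n /\
    n%:R <= 1 + 4 * Num.sqrt (K%:R * (tau m)%:R / L) * ln (tau m)%:R :> R.
  case: m => [|m]; first by exists 0%N.
  have sh : size (hist delta e (tau m.+1) w) = tau m.+1.
    by rewrite size_map size_iota.
  have [n hn nle] := epoch_halts_exists K0 N0 delta01 sh
    (alg_leader run w m) (@alg_picks _ _ _ _ _ _ _ _ _ _ run w m).
  by exists n.
have [n nP] := boolp.choice ex.
exists n; split=> [m m0 _|]; first by have [] := nP m m0.
set M := Num.max _ _; set l := ln _.
have M1 : 1 <= M by rewrite le_max lexx.
have arg_gt0 : 0 < expR 1 + T%:R + K%:R + L.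
  by rewrite -!addrA ltr_pwDl ?expR_gt0// !addr_ge0// ltW.
have l1 : 1 <= l.
  rewrite -[leLHS]expRK ler_ln ?posrE ?expR_gt0// -!addrA lerDl.
  by rewrite !addr_ge0// ltW.
(* For T = 0 the convention ln 0 = 0 applies. *)
have lnTl : ln T%:R <= l.
  case: (posnP T) => [->|T0]; first by rewrite ln0// (le_trans _ l1).
  rewrite ler_ln ?posrE ?ltr0n// [expR 1 + _]addrC -!addrA lerDl.
  by rewrite !addr_ge0 ?expR_ge0// ltW.
have lnT0 : 0 <= ln T%:R :> R.
  by case: (posnP T) => [->|T0]; [rewrite ln0|rewrite ln_ge0 ?ler1n].
have Ml1 : 1 <= M * l by exact: mulr_ege1.
apply: (@le_trans _ _ (6 * (M * l) * (1 + 2 * ln T%:R))).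
  apply: AMO_calls_le; first by rewrite mulr_ge0// (le_trans _ Ml1).
  move=> m m0 mT; have [_ nle] := nP m m0.
  have tau0 : (0 < tau m)%N by case: m m0 {mT nle} => // m _; rewrite expn_gt0.
  have sM : Num.sqrt (K%:R * (tau m)%:R / L) <= M.
    rewrite le_max; apply/orP; right.
    rewrite ler_sqrt ?divr_ge0 ?mulr_ge0 ?(ltW L0)//.
    by rewrite ler_pM2r ?invr_gt0// ler_wpM2l// ler_nat.
  have lnm0 : 0 <= ln (tau m)%:R :> R by rewrite ln_ge0 ?ler1n.
  have lnml : ln (tau m)%:R <= l.
    apply: le_trans lnTl.
    by rewrite ler_ln ?posrE ?ltr0n ?ler_nat// (leq_trans tau0).
  have := ler_pM (sqrtr_ge0 _) lnm0 sM lnml.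
  rewrite natrD -mulrA in nle *; lra.
have : M * l * (1 + 2 * ln T%:R) <= M * l * (3 * l).
  by rewrite ler_wpM2l ?(le_trans _ Ml1)//; lra.
rewrite expr2; lra.
Qed.
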